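(* For every $n\ge 1$, the number $F(n)$ of fixed points of the Pulse update on the complete directed loopless graph $K_n^\rightarrow$ is $$F(n)=1+\begin{cases}1, & \text{if } n-1 \text{ is prime},\\ 0, & \text{otherwise},\end{cases}\;+\sum_{\substack{1\leq m\leq n-1\\ m-1\text{ is prime}\\ m\text{ is not prime}}}\binom{n}{m}.$$
   Context: $K_n^\rightarrow$ denotes the complete directed graph on $n$ vertices (vertex set $V$) with no self-loops: for every pair of vertices $u\neq v$ the edge $u\to v$ is present. The Pulse update on a loopless directed graph $(V,E)$ acts on states $x_t:V\to\{0,1\}$ synchronously: with $k_t(v)=\sum_{u:(u,v)\in E}x_t(u)$, one sets $x_{t+1}(v)=1$ if $k_t(v)$ is a prime number and $x_{t+1}(v)=0$ otherwise. A fixed point is a state that the update leaves unchanged, and $F(n)$ is the number of such states for $K_n^\rightarrow$ (vertices are labeled). *)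

(* Defs.v *)
From mathcomp Require Import all_boot.

Set Implicit Arguments.
Unset Strict Implicit.
Unset Printing Implicit Defensive.

(* A directed graph on a finite vertex type V is given by its edge relation:
   e u v means that there is an edge from u to v.  States V -> {0,1} are
   boolean finite functions, with true = 1 and false = 0. *)

Definition active_indegree (V : finType) (e : rel V) (x : {ffun V -> bool})
    (v : V) : nat :=
  \sum_(u : V | e u v) (x u : nat).

Definition pulse (V : finType) (e : rel V) (x : {ffun V -> bool}) :
    {ffun V -> bool} :=
  [ffun v => prime (active_indegree e x v)].

Definition pulse_fixed_points (V : finType) (e : rel V) :
    {set {ffun V -> bool}} :=
  [set x | pulse e x == x].

Definition complete_digraph (n : nat) : rel 'I_n := fun u v => u != v.
Arguments complete_digraph : clear implicits.

Definition F (n : nat) : nat := #|pulse_fixed_points (complete_digraph n)|.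

(* Main.v *)
Require Import Defs.
From mathcomp Require Import all_boot.

(** In a complete digraph a vertex sees every active vertex except itself, so
    with [m] active vertices an active vertex receives [m - 1] and an inactive
    one receives [m].  Whether a state is fixed therefore depends on [m] only:
    if an active vertex exists then [m - 1] must be prime, and if an inactive
    vertex exists then [m] must not be prime ([fixed_pointE]).  A state is the
    same thing as the set of its active vertices, so [F n] is the sum of
    ['C(n, m)] over the admissible sizes [m] ([card_sets_of_size]).  The two
    extreme sizes, where one of the two kinds of vertices is missing, give the
    separate terms: [m = 0] is always admissible, and [m = n] is admissible
    exactly when [n - 1] is prime. *)

Definition active_set {V : finType} (x : {ffun V -> bool}) : {set V} :=
  [set v | x v].

Lemma active_set_bij (V : finType) : bijective (@active_set V).
Proof.
exists (fun A : {set V} => [ffun v => v \in A]) => [x | A].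
  by apply/ffunP=> v; rewrite ffunE inE.
by apply/setP=> v; rewrite inE ffunE.
Qed.

Lemma active_indegree_complete (n : nat) (x : {ffun 'I_n -> bool}) (v : 'I_n) :
  active_indegree (complete_digraph n) x v = #|active_set x| - x v.
Proof.
have cardE : #|active_set x| = \sum_(u : 'I_n) (x u : nat).
  by rewrite -sum1_card big_mkcond; apply: eq_bigr => u _; rewrite inE; case: (x u).
by rewrite cardE (bigD1 v) //= addKn.
Qed.

(** The two guards make a condition vacuous when no vertex is there to impose
    it: no active vertex for [m = 0], no inactive one for [m = n]. *)
Definition fixed_size (n m : nat) : bool :=
  ((0 < m) ==> prime (m - 1)) && ((m < n) ==> ~~ prime m).

(** All active vertices see one common count and all inactive
    vertices another, so a single vertex of each kind decides. *)
Lemma fixed_pointE (n : nat) (x : {ffun 'I_n -> bool}) :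
  (x \in pulse_fixed_points (complete_digraph n)) = fixed_size n #|active_set x|.
Proof.
have pulseE v : pulse (complete_digraph n) x v = prime (#|active_set x| - x v).
  by rewrite ffunE active_indegree_complete.
rewrite inE; apply/eqP/andP => [fx | [/implyP on /implyP off]].
  split; apply/implyP.
    case/card_gt0P=> v; rewrite inE => xv.
    by move: (pulseE v); rewrite fx xv => <-.
  move=> lt_n; have /card_gt0P [v] : 0 < #|~: active_set x|.
    by rewrite cardsCs setCK card_ord subn_gt0.
  rewrite !inE => /negbTE xv.
  by move: (pulseE v); rewrite fx xv subn0 => <-.
apply/ffunP=> v; rewrite pulseE; case xv: (x v).
  by apply: on; apply/card_gt0P; exists v; rewrite inE.
rewrite subn0; apply/negbTE/off.
rewrite -[n in _ < n]card_ord -cardsT; apply: proper_card.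
by apply/properP; split; [exact: subsetT | exists v; rewrite ?inE ?xv].
Qed.

Lemma card_sets_of_size (T : finType) (Q : pred nat) :
  #|[set A : {set T} | Q #|A|]| = \sum_(0 <= m < #|T|.+1 | Q m) 'C(#|T|, m).
Proof.
pose size_of (A : {set T}) : 'I_#|T|.+1 := inord #|A|.
have size_ofE A : size_of A = #|A| :> nat by rewrite inordK // ltnS max_card.
rewrite big_mkord -sum1_card (partition_big size_of (fun m => Q m)) /=; last first.
  by move=> A; rewrite inE size_ofE.
apply: eq_bigr => m Qm; rewrite -card_draws -[RHS]sum1_card.
apply: eq_bigl => A; rewrite !inE -val_eqE /= size_ofE.
by case: eqP => [->|]; rewrite ?Qm ?andbF.
Qed.

Theorem proposition15 (n : nat) (hn : 1 <= n) :
  F n = 1 + (if prime (n - 1) then 1 else 0)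
          + \sum_(1 <= m < n | prime (m - 1) && ~~ prime m) 'C(n, m).
Proof.
have -> : F n = \sum_(0 <= m < n.+1 | fixed_size n m) 'C(n, m).
  have := card_sets_of_size 'I_n (fixed_size n); rewrite card_ord => <-.
  rewrite -(on_card_preimset (onW_bij _ (active_set_bij 'I_n))).
  by apply: eq_card => x; rewrite fixed_pointE !inE.
have size0 : fixed_size n 0 by rewrite /fixed_size hn.
have sizen : fixed_size n n = prime (n - 1).
  by rewrite /fixed_size hn ltnn andbT.
rewrite big_mkcond big_nat_recr //= big_ltn // size0 sizen bin0 binn.
rewrite -!addnA; congr (_ + _).
rewrite addnC; congr (_ + _).
rewrite [RHS]big_mkcond; apply: eq_big_nat => m /andP [m0 mn].
by rewrite /fixed_size m0 mn.
Qed.
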